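(* Let $S$ be a semiring that is multiplicatively generated by nilidempotents, and suppose that every idempotent in $S$ has a nilorthogonal complement. If $\mathcal{N}(S)\subseteq V(S)\cap Z(S)$, then $S$ is commutative (i.e. $ab=ba$ for all $a,b\in S$).
   Context: A semiring is a set $S$ with binary operations $+$ and $\cdot$ such that $(S,+)$ is a commutative monoid with identity element $0$, $(S,\cdot)$ is a (not necessarily commutative) monoid with identity element $1$, multiplication distributes over addition on both sides, and $0\cdot a=a\cdot 0=0$ for all $a\in S$. An element $e\in S$ is idempotent if $e^2=e$. An element $x\in S$ is nilpotent if $x^k=0$ for some positive integer $k$; $\mathcal{N}(S)$ denotes the set of all nilpotent elements of $S$. An element $e\in S$ is nilidempotent if $e^2=e+x$ for some $x\in\mathcal{N}(S)$. $V(S)$ denotes the set of additively invertible elements of $S$, i.e. those $a\in S$ for which there is $b\in S$ with $a+b=0$. $Z(S)$ denotes the centre of $S$, i.e. the set of $a\in S$ with $ab=ba$ for all $b\in S$. The semiring $S$ is multiplicatively generated by nilidempotents if every element of $S$ is a finite product of nilidempotents of $S$. A nilidempotent $e\in S$ (in particular, an idempotent) has a nilorthogonal complement if there exist a nilidempotent $f\in S$ and a nilpotent $x\in S$ such that $e+f=1+x$ and $ef,fe\in\mathcal{N}(S)$. *)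

(* Defs.v *)
From mathcomp Require Import all_boot all_algebra.
Set Implicit Arguments.
Unset Strict Implicit.
Unset Printing Implicit Defensive.
Import GRing.Theory.
Local Open Scope ring_scope.

(* A semiring is a [pzSemiRingType]: multiplication need not commute, and the
   zero semiring (0 = 1) is allowed. *)

Definition is_idempotent (S : pzSemiRingType) (e : S) : Prop := e ^+ 2 = e.

Definition nilpotent_elt (S : pzSemiRingType) (x : S) : Prop :=
  exists2 k : nat, (0 < k)%N & x ^+ k = 0.

Definition nilidempotent (S : pzSemiRingType) (e : S) : Prop :=
  exists2 x : S, nilpotent_elt x & e ^+ 2 = e + x.

Definition add_invertible (S : pzSemiRingType) (a : S) : Prop :=
  exists b : S, a + b = 0.

Definition central (S : pzSemiRingType) (a : S) : Prop :=
  forall b : S, GRing.comm a b.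

(* The empty product 1 is allowed; this is harmless since 1 is idempotent. *)
Definition mult_generated_by_nilidempotents (S : pzSemiRingType) : Prop :=
  forall a : S, exists2 s : seq S,
    (forall e : S, e \in s -> nilidempotent e) & a = \prod_(e <- s) e.

Definition has_nilorthogonal_complement (S : pzSemiRingType) (e : S) : Prop :=
  exists f x : S,
    [/\ nilidempotent f, nilpotent_elt x, e + f = 1 + x,
        nilpotent_elt (e * f) & nilpotent_elt (f * e)].

(* Main.v *)
Require Import Defs.
From mathcomp Require Import all_boot all_algebra.
Import GRing.Theory.
Local Open Scope ring_scope.
Set Implicit Arguments.
Unset Strict Implicit.

(** For an idempotent [e] with nilorthogonal complement [f], the elements
    [e a f] and [f a e] are nilpotent, hence central; multiplying
    [e a + e a x = e a e + e a f] by [e] on the right therefore changes nothing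
    but the first summand, and cancelling [e a x] gives [e a = e a e].
    Symmetrically [a e = e a e], so idempotents are central.  The usual lifting
    step [e |-> 3 e^2 - 2 e^3] moves a nilidempotent by a central nilpotent while
    lowering the nilpotency index of [e^2 - e]; so nilidempotents are central
    too, and so are their products. *)

Lemma addIr_inv (S : pzSemiRingType) (a b c : S) :
  add_invertible c -> a + c = b + c -> a = b.
Proof.
move=> [d cd0] eq_ac; have := congr1 (+%R^~ d) eq_ac.
by rewrite -!addrA cd0 !addr0.
Qed.

Lemma nilpotent_centralM (S : pzSemiRingType) (z b : S) :
  central z -> nilpotent_elt z -> nilpotent_elt (z * b).
Proof.
move=> cz [k k_gt0 zk0]; exists k => //.
by rewrite (exprMn_comm _ (cz b)) zk0 mul0r.
Qed.

Lemma nilpotent_sqr (S : pzSemiRingType) (z : S) :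
  nilpotent_elt (z * z) -> nilpotent_elt z.
Proof.
move=> [k k_gt0 zk0]; exists (2 * k)%N; first by rewrite muln_gt0.
by rewrite exprM expr2.
Qed.

Lemma central_opp (S : pzSemiRingType) (x y : S) :
  central x -> x + y = 0 -> central y.
Proof.
move=> cx xy0 b; apply: (@addIr_inv _ _ _ (x * b)).
  by exists (y * b); rewrite -mulrDl xy0 mul0r.
by rewrite [in RHS](cx b) -mulrDl -mulrDr ![y + x]addrC xy0 mul0r mulr0.
Qed.

Lemma centralD (S : pzSemiRingType) (a b : S) :
  central a -> central b -> central (a + b).
Proof. by move=> ca cb c; rewrite /GRing.comm mulrDl mulrDr ca cb. Qed.

Lemma idempotent_central (S : pzSemiRingType) (e : S) :
    (forall x : S, nilpotent_elt x -> add_invertible x /\ central x) ->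
  is_idempotent e -> has_nilorthogonal_complement e -> central e.
Proof.
move=> hnil; rewrite /is_idempotent expr2 => ee.
move=> [f [x [_ nx ef nef nfe]]] a.
have [_ cx] := hnil _ nx; have [_ cef] := hnil _ nef.
have [_ cfe] := hnil _ nfe.
have nxM b : nilpotent_elt (x * b) by apply: nilpotent_centralM.
(* The square contains the inner factor [f * e], a central nilpotent; moved to the front, it makes
   the whole square nilpotent. For [f * a * e] the inner factor is [e * f]. *)
have nl : nilpotent_elt (e * a * f).
  apply: nilpotent_sqr.
  have -> : e * a * f * (e * a * f) = (f * e) * (e * a * (a * f)).
    by rewrite [RHS]mulrA (cfe (e * a)) !mulrA.
  exact: nilpotent_centralM.
have nr : nilpotent_elt (f * a * e).
  apply: nilpotent_sqr.
  have -> : f * a * e * (f * a * e) = (e * f) * (f * a * (a * e)).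
    by rewrite [RHS]mulrA (cef (f * a)) !mulrA.
  exact: nilpotent_centralM.
have eaE : e * a = e * a * e.
  have [inv_xea cxea] := hnil _ (nxM (e * a)).
  have [_ cl] := hnil _ nl.
  (* By centrality the trailing [e] passes to the front, where the leading [e] absorbs it; the same
     happens with [x * (e * a)]. *)
  have eaf_e : e * a * f * e = e * a * f by rewrite cl !mulrA ee.
  have eax_e : x * (e * a * e) = x * (e * a).
    by rewrite mulrA (cxea e) mulrA -(cx e) -mulrA [e * (e * a)]mulrA ee.
  have split_ea : e * a + x * (e * a) = e * a * e + e * a * f.
    by rewrite -mulrDr ef mulrDr mulr1 cx.
  apply: (addIr_inv inv_xea); rewrite split_ea.
  have := congr1 ( *%R^~ e) split_ea.
  rewrite !mulrDl eaf_e -(mulrA (e * a) e e) ee -(mulrA x (e * a) e) eax_e.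
  by move=> <-.
have aeE : a * e = e * a * e.
  have [inv_xae cxae] := hnil _ (nxM (a * e)).
  have [_ cr] := hnil _ nr.
  have e_fae : e * (f * a * e) = f * a * e by rewrite -cr -!mulrA ee.
  have e_xae : x * (e * a * e) = x * (a * e).
    rewrite -mulrA [x * _]mulrA (cx e) -mulrA -(cxae e).
    by rewrite -!mulrA ee.
  have split_ae : a * e + x * (a * e) = e * a * e + f * a * e.
    by rewrite -!mulrDl ef mulrDl mul1r mulrDl mulrA.
  apply: (addIr_inv inv_xae); rewrite split_ae.
  have := congr1 ( *%R e) split_ae.
  rewrite !mulrDr e_fae (mulrA e x) -(cx e) -(mulrA x e) !mulrA ee.
  rewrite -[x * e * a * e]mulrA -[x * e * _]mulrA [e * (a * e)]mulrA e_xae.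
  by rewrite mulrA => <-.
by rewrite /GRing.comm eaE aeE.
Qed.

(* With [y = - x], the new element is [3 e^2 - 2 e^3 = e + x - 2 e x]. *)
Lemma idempotent_lift_step (S : pzSemiRingType) (e x y : S) :
    central x -> central y -> x + y = 0 -> e * e = e + x ->
  let e' := e + (x + (e * y) *+ 2) in
  e' * e' = e' + x * y * (3%:R + y *+ 4).
Proof.
move=> cx cy xy0 ee /=.
set q := e * y; set u := x + q *+ 2.
(* Since [e * x + q = e * (x + y) = 0], one of the two copies of [q] cancels [e * x]. *)
have eu : e * u = q + (x * y) *+ 2.
  have eq : e * q = q + x * y by rewrite mulrA ee mulrDl.
  rewrite mulrDr mulrnAr eq mulrnDl addrA mulr2n addrA -[e * x + q]mulrDr xy0.
  by rewrite mulr0 add0r.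
have ue : u * e = e * u.
  rewrite mulrDl mulrDr cx mulrnAl mulrnAr.
  by rewrite /q -(cy e) mulrA (cy e) -!mulrA (cy e).
have qu : q * u = y * q + (x * y * y) *+ 2.
  by rewrite /q -mulrA (cy u) mulrA eu mulrDl mulrnAl (cy (e * y)).
have uu : u * u = x * x + (x * y * y) *+ 4.
  rewrite {1}/u mulrDl mulrnAl qu mulrDr mulrnAr mulrnDl -mulrnA.
  by rewrite addrA -[x * x + _ + _]addrA -mulrnDl -mulrDl xy0 mul0r mul0rn addr0.
have sqrD a b : (a + b) * (a + b) = a * a + a * b + (b * a + b * b) :> S.
  by rewrite mulrDl !mulrDr.
rewrite sqrD ee ue eu uu.
have xyE : x * y * (3%:R + y *+ 4) = (x * y) *+ 3 + (x * y * y) *+ 4.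
  by rewrite mulrDr mulr_natr mulrnAr.
have xxy : x * x + x * y = 0 by rewrite -mulrDr xy0 mulr0.
(* The left side has four copies of [x * y] and one [x * x], the right side three copies of [x * y];
   adding the zero [x * x + x * y] on the right balances them without subtraction. *)
rewrite xyE -[RHS]addr0 -xxy /u; move: (x * y) (x * x) (x * y * y *+ 4) => t s v.
rewrite !mulrS !mulr0n !addr0 !addrA.
by rewrite [LHS](ACl (1*2*3*6*4*5*7*10*9*8)).
Qed.

Lemma nilidempotent_central (S : pzSemiRingType) (e : S) :
    (forall x : S, nilpotent_elt x -> add_invertible x /\ central x) ->
    (forall g : S, is_idempotent g -> central g) ->
  nilidempotent e -> central e.
Proof.
move=> hnil hidem [x [[//|k] _ xk0]]; rewrite expr2 => ee.
(* Here [x ^+ k.+1 = 0], so the base case is [x = 0]. Lifting changes both [e] and [x], hence the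
   generalisation. *)
elim: k => [|k IHk] in e x xk0 ee *.
  by apply: hidem; rewrite /is_idempotent expr2 ee -[x]expr1 xk0 addr0.
have nx : nilpotent_elt x by exists k.+2.
have [[y xy0] cx] := hnil x nx; have cy := central_opp cx xy0.
set e' := e + (x + (e * y) *+ 2).
have ce' : central e'.
  apply: IHk (idempotent_lift_step cx cy xy0 ee).
  rewrite -mulrA (exprMn_comm _ (cx _)) (exprS (y * _)) !mulrA.
  (* As [y] is [- x], this product is [- x ^+ k.+2]; so the new error term already vanishes at the
     power [k.+1]. *)
  have -> : x ^+ k.+1 * y = 0.
    have := mulr0 (x ^+ k.+1).
    by rewrite -xy0 mulrDr -exprSr xk0 add0r.
  by rewrite !mul0r.
have cex : central (x * e).
  by apply: (hnil _ _).2; apply: nilpotent_centralM.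
(* Adding [- x + 2 x e] undoes the lift, and these terms are central because [x * e] is nilpotent,
   whatever [e] is. *)
have -> : e = e' + (y + (x * e + x * e)).
  rewrite -mulr2n cx /e' -addrA [x + _ + _]addrACA xy0 add0r -mulrnDl -mulrDr.
  by rewrite [y + x]addrC xy0 mulr0 mul0rn addr0.
exact: centralD ce' (centralD cy (centralD cex cex)).
Qed.

Theorem theorem3p5 (S : pzSemiRingType)
    (hgen : mult_generated_by_nilidempotents S)
    (hcompl : forall e : S, is_idempotent e -> has_nilorthogonal_complement e)
    (hnil : forall x : S, nilpotent_elt x -> add_invertible x /\ central x) :
  forall a b : S, a * b = b * a.
Proof.
move=> a b; have [s hs ->] := hgen a.
symmetry; rewrite big_seq; apply: commr_prod => e /hs ne.
symmetry; apply: nilidempotent_central ne b => // g idg.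
exact: idempotent_central (hcompl g idg).
Qed.
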